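(* Let $n\ge1$, $r\ge2$, $h\ge2$ be integers and $\alpha\in(0,1]$. If $h\ge r$, then the cell-suppression mechanism $M(x,\cdot)=\prod_{i=1}^nM_i^h(x_i,\cdot)$ on $\mathsf{X}=\mathbb{N}^n$ satisfies $(\mathcal{L}_n^r,\mathcal{C}_n^{h,\alpha},-\log\alpha,0)$-PP.
   Context: Mechanism: data are vectors of counts $x\in\mathsf{X}=\mathbb{N}^n$. For each cell $i$, $M_i^h$ is the deterministic kernel from $\mathbb{N}$ to $\mathbb{N}\cup\{-1\}$ with $M_i^h(x_i,\{x_i\})=1$ if $x_i\ge h$ and $M_i^h(x_i,\{-1\})=1$ otherwise ($-1$ denotes suppression). Scores: with $q_i$ the $i$th marginal probability mass function of a distribution $Q$ on $\mathbb{N}^n$, $$L_i^r(Q,x)=\begin{cases}-\log q_i(x_i)&\text{if }x_i<r,\\ \infty&\text{if }x_i\ge r,\end{cases}$$ with $\log0=-\infty$, and $\mathcal{L}_n^r=\{L_i^r\}_{i=1}^n$. Priors: $\mathcal{C}^{h,\alpha}$ is the set of probability distributions $P$ on $\mathbb{N}$ with $P(\{z:z<h\})\ge\alpha$; $\mathcal{C}_n^{h,\alpha}$ is the set of product distributions $Q=Q_1\otimes\cdots\otimes Q_n$ with every $Q_i\in\mathcal{C}^{h,\alpha}$. Posterior: $Q_T$ is the Bayes posterior of $Q$ after observing $T\sim M(x,\cdot)$. Cells being independent, it is the product of the cellwise posteriors: for cell $i$, $Q_i$ conditioned on $\{z<h\}$ if $T_i=-1$, and the point mass at $T_i$ if $T_i\ge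 h$. Persuasive privacy: $M$ is $(\mathcal{S},\mathcal{Q},\kappa,\delta)$-PP if $$\inf_{S\in\mathcal{S}}\inf_{x\in\mathsf{X}}\inf_{Q\in\mathcal{Q}}\mathbb{P}_x\left[\Delta_S(Q,T,x)\le\kappa\right]\ge1-\delta,\qquad\Delta_S(Q,T,x)=S(Q,x)-S(Q_T,x),$$ where $\mathbb{P}_x$ is probability under $T\sim M(x,\cdot)$, with the convention $\infty-\infty=0$. *)

(* Defs.v *)
From HB Require Import structures.
From mathcomp Require Import all_boot all_order all_algebra.
From mathcomp Require Import all_classical all_reals all_analysis.
From mathcomp Require Import measurable_realfun.

Set Implicit Arguments.
Unset Strict Implicit.
Unset Printing Implicit Defensive.

Import Order.TTheory GRing.Theory Num.Theory.
Import numFieldNormedType.Exports.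

Local Open Scope classical_set_scope.
Local Open Scope ring_scope.
Local Open Scope ereal_scope.

(* Outputs of a cell, N with an extra symbol -1 for suppression, are encoded in
   option nat: None is -1 and Some z is the released count z. *)
HB.instance Definition _ := @isMeasurable.Build default_measure_display
  (option nat) discrete_measurable discrete_measurable0
  discrete_measurableC discrete_measurableU.

Lemma discrete_tuple_measurable d (T : measurableType d) n
    (A : set (n.-tuple T)) :
  (forall B : set T, measurable B) -> countable A -> measurable A.
Proof.
move=> mT cA; apply: countable_measurable => // x.
rewrite (_ : [set x] =
    \bigcap_(i in [set: 'I_n]) ((@tnth _ _ ^~ i) @^-1` [set tnth x i])).
  apply: fin_bigcap_measurable => // i _.
  by rewrite -[X in measurable X]setTI; exact: measurable_tnth.
apply/seteqP; split => [_ -> //|y /= yx].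
by apply: eq_from_tnth => i; exact: yx.
Qed.

(* The (product) sigma-algebras on counts and on outputs are discrete. *)
Lemma measurable_counts n (A : set (n.-tuple nat)) : measurable A.
Proof. by apply: discrete_tuple_measurable => //; exact: countableP. Qed.

Lemma measurable_outputs n (A : set (n.-tuple (option nat))) : measurable A.
Proof. by apply: discrete_tuple_measurable => //; exact: countableP. Qed.

Section cons_tuple.
Context d (T : measurableType d) (n : nat).

Definition cons_pair (p : T * n.-tuple T) : n.+1.-tuple T :=
  [tuple of p.1 :: p.2].

Lemma measurable_cons_pair : measurable_fun [set: T * n.-tuple T] cons_pair.
Proof. by apply: measurable_cons; [exact: measurable_fst|exact: measurable_snd].
Qed.

HB.instance Definition _ :=
  @isMeasurableFun.Build _ _ _ _ cons_pair measurable_cons_pair.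
End cons_tuple.

Section product_probability.
Context d (T : measurableType d) (R : realType).

(* The product measure P_0 (x) ... (x) P_(n-1) on n-tuples, built from binary
   products; it is characterized by its values on boxes, see pprod_rect. *)
Fixpoint pprod (n : nat) : ('I_n -> probability T R) ->
    probability (n.-tuple T) R :=
  match n with
  | 0%N => fun _ => \d_[tuple]
  | m.+1 => fun P =>
      distribution (P ord0 \x pprod (fun i => P (lift ord0 i)))
        (@cons_pair _ T m)
  end.

Lemma pprod_rect n (P : 'I_n -> probability T R) (A : 'I_n -> set T) :
  (forall i, measurable (A i)) ->
  pprod P [set x | forall i, A i (tnth x i)] = \prod_(i < n) P i (A i).
Proof.
elim: n P A => [|n IH] P A mA /=.
  rewrite big_ord0 diracE mem_set//= => -[].
  by [].
rewrite big_ord_recl /= /distribution /pushforward /=.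
rewrite -(IH (fun i => P (lift ord0 i)) (fun i => A (lift ord0 i)))//.
rewrite -product_measure1E//.
  congr (_ _); apply/seteqP; split => [[a x] /= h|[a x] /= [h0 h] i].
    split; first exact: (h ord0).
    by move=> i; have := h (lift ord0 i); rewrite tnthS.
  have [->//|] := eqVneq i ord0.
  move=> /eqP i0; case: (unliftP ord0 i) => [j ->|//].
  by rewrite tnthS; exact: h.
rewrite (_ : [set _ | _] =
    \bigcap_(i in [set: 'I_n]) ((@tnth _ _ ^~ i) @^-1` A (lift ord0 i))).
  apply: fin_bigcap_measurable => // i _.
  by rewrite -[X in measurable X]setTI; exact: measurable_tnth.
by apply/seteqP; split => [x /= h i _|x /= h i]; exact: h.
Qed.

End product_probability.

Section persuasive_privacy.
Context (R : realType) (n : nat).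
Local Notation X := (n.-tuple nat).
Local Notation Y := (n.-tuple (option nat)).

Section likelihood.
Variables (M : R.-pker X ~> Y) (Q : probability X R) (t : Y).

(* The joint probability, when x ~ Q and T ~ M(x, .), that x \in A and T = t. *)
Definition joint_mass (A : set X) : \bar R := \int[Q]_(x in A) M x [set t].

Let joint_mass0 : joint_mass set0 = 0.
Proof. exact: integral_set0. Qed.

Let joint_mass_ge0 A : 0 <= joint_mass A.
Proof. by apply: integral_ge0 => x _; exact: measure_ge0. Qed.

Let joint_mass_sigma_additive : semi_sigma_additive joint_mass.
Proof.
apply: semi_sigma_additive_nng_induced => [|x]; last exact: measure_ge0.
by apply: measurable_kernel; exact: measurable_outputs.
Qed.

HB.instance Definition _ := isMeasure.Build _ _ _ joint_mass
  joint_mass0 joint_mass_ge0 joint_mass_sigma_additive.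
End likelihood.

(* Bayes' rule. On an output t of prior predictive probability zero the rule is
   void, and the posterior is then null Q t: mnormalize returns its second
   argument when the total mass is zero. *)
Definition posterior (M : R.-pker X ~> Y)
    (null : probability X R -> Y -> probability X R)
    (Q : probability X R) (t : Y) : probability X R :=
  mnormalize (joint_mass M Q t) (null Q t).

(* The library has +oo - +oo = -oo, whereas score differences use 0. *)
Definition esub (a b : \bar R) : \bar R :=
  if (a == +oo) && (b == +oo) then 0 else a - b.

Definition score : Type := probability X R -> X -> \bar R.

Definition PP (M : R.-pker X ~> Y)
    (null : probability X R -> Y -> probability X R)
    (SS : set score) (QQ : set (probability X R)) (kappa delta : R) : Prop :=
  (1 - delta)%:E <=
  ereal_inf [set ereal_inf [set ereal_inf
    [set M x [set t | esub (S Q x) (S (posterior M null Q t) x) <= kappa%:E]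
      | Q in QQ] | x in [set: X]] | S in SS].

End persuasive_privacy.

Section cell_suppression.
Context (R : realType).

Definition cell_suppression (h z : nat) : probability (option nat) R :=
  \d_(if (h <= z)%N then Some z else None).

Section mechanism.
Variables (n h : nat).

Definition suppression (x : n.-tuple nat) :
    {measure set (n.-tuple (option nat)) -> \bar R} :=
  pprod (fun i => cell_suppression h (tnth x i)).

Let measurable_suppression U : measurable U ->
  measurable_fun [set: n.-tuple nat] (suppression ^~ U).
Proof. by move=> mU _ V mV; exact: measurable_counts. Qed.

HB.instance Definition _ := @isKernel.Build _ _ _ _ R suppression
  measurable_suppression.

Let suppression_prob x : suppression x [set: _] = 1.
Proof. exact: probability_setT. Qed.

HB.instance Definition _ := @Kernel_isProbability.Build _ _ _ _ R suppression
  suppression_prob.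
End mechanism.

Definition below (h : nat) : set nat := [set z | (z < h)%N].

Lemma measurable_below h : measurable (below h).
Proof. by []. Qed.

(* None is the event {z < h}. The second argument of mnormalize is a dummy for
   the case where P gives that event probability zero, and Some z with z < h is
   never output. *)
Definition cell_posterior (h : nat) (P : probability nat R) (t : option nat) :
    probability nat R :=
  match t with
  | Some z => \d_z
  | None => mnormalize (mrestr P (measurable_below h)) P
  end.

Section scores_priors.
Variable n : nat.

Definition cell_count (i : 'I_n) (x : n.-tuple nat) : nat := tnth x i.

HB.instance Definition _ (i : 'I_n) :=
  @isMeasurableFun.Build _ _ _ _ (cell_count i) (measurable_tnth i).

Definition marginal (Q : probability (n.-tuple nat) R) (i : 'I_n) :
    probability nat R :=
  distribution Q (cell_count i).

(* For a product prior and a possible output this is what Bayes' rule gives; it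
   also fixes the posterior on the outputs of prior predictive probability
   zero, where Some z always gives the point mass at z. *)
Definition cellwise_posterior (h : nat) (Q : probability (n.-tuple nat) R)
    (t : n.-tuple (option nat)) : probability (n.-tuple nat) R :=
  pprod (fun i => cell_posterior h (marginal Q i) (tnth t i)).

(* lne 0 = -oo, so the score of an impossible count is +oo. *)
Definition log_score (r : nat) (i : 'I_n) : score R n := fun Q x =>
  if (tnth x i < r)%N then - lne (marginal Q i [set tnth x i]) else +oo.

Definition log_scores (r : nat) : set (score R n) := range (log_score r).

Definition cell_prior (h : nat) (alpha : R) : set (probability nat R) :=
  [set P | alpha%:E <= P (below h)].

Definition product_priors (h : nat) (alpha : R) :
    set (probability (n.-tuple nat) R) :=
  [set pprod P | P in [set P : 'I_n -> probability nat R |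
                        forall i, cell_prior h alpha (P i)]].
End scores_priors.
End cell_suppression.

Arguments suppression {R} n h x.
Arguments cellwise_posterior {R n} h Q t.
Arguments log_scores {R} n r.
Arguments product_priors {R} n h alpha.

(* Main.v *)
Require Import Defs.
From mathcomp Require Import all_boot all_order all_algebra.
From mathcomp Require Import all_classical all_reals all_analysis.

(** Suppression is deterministic, so for given data x a single output t occurs,
    and the claim is one inequality between scores, for every product prior
    Q = P_0 (x) ... (x) P_(n-1) and every cell i.

    If x_i >= r, both scores of cell i are infinite, their difference is 0 by
    convention, and 0 <= - ln alpha because alpha <= 1.

    If x_i < r, then x_i < h because r <= h, so cell i is suppressed. The
    likelihood of t is the indicator of a box, the set of all data that produce
    t, whose i-th side is {z | z < h}. Conditioning a product distribution on a
    box conditions each factor on its side; hence the i-th marginal of the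
    posterior is P_i conditioned on {z | z < h} ([marginal_posterior]). If the
    box is null, Bayes' rule is void, but the posterior chosen there has the
    same i-th marginal. Conditioning divides the mass of x_i by
    p = P_i {z | z < h} >= alpha, so the score drops by - ln p <= - ln alpha, or
    stays infinite if x_i has prior mass 0 ([esub_lne_le]). *)

Set Implicit Arguments.
Unset Strict Implicit.
Unset Printing Implicit Defensive.

Import Order.TTheory GRing.Theory Num.Theory.

Local Open Scope classical_set_scope.
Local Open Scope ring_scope.

Section score_difference.
Local Open Scope ereal_scope.

(** Replacing the probability [q] of the true count by [q / p] lowers its
    logarithmic score by exactly [- ln p] when [q] is positive. When [q] is 0
    both scores are infinite and the bound holds because [esub +oo +oo] is 0. *)
Lemma esub_lne_le (R : realType) (alpha p q : R) :
  (0 < alpha)%R -> (alpha <= p)%R -> (p <= 1)%R -> (0 <= q)%R ->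
  esub (- lne q%:E) (- lne (q / p)%:E) <= (- ln alpha)%:E.
Proof.
move=> a0 ap p1; have p0 : (0 < p)%R by exact: lt_le_trans ap.
have ln_ap : (ln alpha <= ln p)%R by rewrite ler_ln.
rewrite le_eqVlt => /predU1P[<-|q0].
  rewrite mul0r /lne lexx /esub /= lee_fin oppr_ge0.
  by rewrite (le_trans ln_ap)// ln_le0.
rewrite !lne_EFin ?divr_gt0// /esub /= lee_fin ln_div//.
by rewrite opprK addKr lerN2.
Qed.

End score_difference.

Section mnormalize_scale.
Local Open Scope ereal_scope.

(** The factor [c] is common to numerator and denominator, so it cancels unless
    [mu] has total mass 0; [mnormalize mu P] is then [P], whence the last
    hypothesis. *)
Lemma mnormalize_scale d d' (T : measurableType d) (T' : measurableType d')
    (R : realType) (mu : {measure set T -> \bar R})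
    (nu : {measure set T' -> \bar R}) (P : probability T R)
    (P' : probability T' R) (c : \bar R) (U : set T) (V : set T') :
  nu setT \is a fin_num -> nu V \is a fin_num -> c \is a fin_num ->
  mu setT = nu setT * c -> mu U = nu V * c ->
  (mu setT = 0 -> P U = mnormalize nu P' V) ->
  mnormalize mu P U = mnormalize nu P' V.
Proof.
move=> nuT nuV c_fin muT muU null; rewrite {1}/mnormalize.
have [/null <-//|] := eqVneq (mu setT) 0.
rewrite /= /mnormalize muT -(fineK nuT) -(fineK c_fin) -EFinM /= !eqe.
rewrite mulf_eq0 negb_or => /andP[T0 c0]; rewrite (negbTE T0) /= muU.
rewrite -(fineK nuV) -(fineK c_fin) -!EFinM.
by rewrite invfM mulrACA divff// mulr1.
Qed.

End mnormalize_scale.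

Section product_distribution.
Local Open Scope ereal_scope.
Context (R : realType) (n : nat).

(** An intersection of a box with a condition on coordinate i is again a box,
    whose probability splits off the i-th factor; the other factors are what
    cancels when a marginal of the conditional distribution is computed. *)
Lemma pprod_rect_cell (P : 'I_n -> probability nat R) (B : 'I_n -> set nat)
    (i : 'I_n) (A : set nat) :
  pprod P ((cell_count i) @^-1` A `&` [set y | forall j, B j (tnth y j)]) =
  P i (A `&` B i) * \prod_(j < n | j != i) P j (B j).
Proof.
pose C j := if j == i then A `&` B j else B j.
rewrite (_ : _ `&` _ = [set y | forall j, C j (tnth y j)]); last first.
  apply/seteqP; split=> [y [Ay By] j|y Cy].
    by rewrite /C; case: eqVneq => [->|_]; [split=> //; exact: By|exact: By].
  split; first by have := Cy i; rewrite /C eqxx => -[].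
  by move=> j; have := Cy j; rewrite /C; case: eqP => // _ [].
rewrite pprod_rect// (bigD1 i)//= /C eqxx; congr (_ * _).
by apply: eq_bigr => j /negbTE ->.
Qed.

Lemma marginal_pprod (P : 'I_n -> probability nat R) (i : 'I_n) (A : set nat) :
  marginal (pprod P) i A = P i A.
Proof.
rewrite -[LHS]/(pprod P (cell_count i @^-1` A)) -[_ @^-1` _]setIT.
rewrite (_ : setT = [set y | forall j, [set: nat] (tnth y j)]); last first.
  by apply/seteqP; split.
rewrite (pprod_rect_cell P (fun _ => setT)) setIT big1 ?mule1// => j _.
exact: probability_setT.
Qed.

End product_distribution.

Section suppression.
Local Open Scope ereal_scope.
Context (R : realType) (n h : nat).
Implicit Types (x : n.-tuple nat) (t : n.-tuple (option nat)).

Definition suppressed_cell (z : nat) : option nat :=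
  if (h <= z)%N then Some z else None.

Definition suppressed x : n.-tuple (option nat) :=
  [tuple of map suppressed_cell x].

Lemma suppressed_cell_None z : (z < h)%N -> suppressed_cell z = None.
Proof. by move=> zh; rewrite /suppressed_cell leqNgt zh. Qed.

Lemma cell_posterior_None (P : probability nat R) A :
  cell_posterior h P None A =
  if P (below h) == 0 then P A
  else P (A `&` below h) * ((fine (P (below h)))^-1)%:E.
Proof.
rewrite -[LHS]/((if (P (setT `&` below h) == 0) || (P (setT `&` below h) == +oo)
  then fun U => P U
  else fun U => P (U `&` below h) * ((fine (P (setT `&` below h)))^-1)%:E) A).
have : P (below h) \is a fin_num by exact: fin_num_measure.
rewrite setTI fin_numE => /andP[_ /negbTE ->]; rewrite orbF.
by case: ifP.
Qed.

(** Both sides are probabilities, so it is enough that every event containing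
    [suppressed x] has probability 1; it contains the singleton of
    [suppressed x], which is a box. *)
Lemma suppression_dirac x A :
  suppression (R := R) n h x A = \d_(suppressed x) A.
Proof.
pose D i := cell_suppression R h (tnth x i).
rewrite -[LHS]/(pprod D A).
have out1 U : U (suppressed x) -> pprod D U = 1.
  move=> Ux; apply/eqP; rewrite eq_le probability_le1/=; last first.
    exact: measurable_outputs.
  have <- : pprod D
      [set t | forall i, [set suppressed_cell (tnth x i)] (tnth t i)] = 1.
    rewrite (pprod_rect D (fun i => I : measurable [set suppressed_cell (tnth x i)])).
    rewrite big1// => i _; rewrite /D /cell_suppression /= diracE mem_set//.
  apply: le_measure; rewrite ?inE; [exact: measurable_outputs..|].
  move=> t /= tx; rewrite (_ : t = suppressed x)//.
  by apply: eq_from_tnth => i; rewrite tx tnth_map.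
rewrite diracE; have [|] := boolP (suppressed x \in A).
  by rewrite inE => /out1.
rewrite notin_setE => nAx; rewrite -[A]setCK probability_setC.
  by rewrite out1//= subee.
exact: measurable_outputs.
Qed.

(** The data that produce [t] form the box with these sides. *)
Let side t j : set nat := [set z | suppressed_cell z = tnth t j].

Lemma joint_mass_suppression (Q : probability (n.-tuple nat) R) t A :
  joint_mass (suppression n h) Q t A =
  Q (A `&` [set y | forall j, side t j (tnth y j)]).
Proof.
rewrite /joint_mass setIC -(@integral_indic _ _ _ _ A)//.
- apply: eq_integral => y _; rewrite suppression_dirac diracE indicE.
  congr (_%:R%:E); congr nat_of_bool; apply/idP/idP; rewrite !inE /=.
    by move=> <- j; rewrite /side /= tnth_map.
  by move=> By; apply: eq_from_tnth => j; rewrite tnth_map; exact: By.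
- exact: measurable_counts.
- exact: measurable_counts.
Qed.

(** A suppressed cell i leaves only the event z < h about that cell, and by
    independence the other cells say nothing more about it. *)
Lemma marginal_posterior (P : 'I_n -> probability nat R) x (i : 'I_n) A :
  (tnth x i < h)%N ->
  marginal (posterior (suppression n h) (cellwise_posterior h) (pprod P)
    (suppressed x)) i A = cell_posterior h (P i) None A.
Proof.
move=> xih; set t := suppressed x.
have ti : tnth t i = None by rewrite tnth_map suppressed_cell_None.
have side_i : side t i = below h.
  rewrite /side ti /below /suppressed_cell; apply/seteqP.
  by split=> z /=; case: leqP.
pose c := \prod_(j < n | j != i) P j (side t j).
have massE U : joint_mass (suppression n h) (pprod P) t (cell_count i @^-1` U) =
    P i (U `&` below h) * c.
  by rewrite joint_mass_suppression pprod_rect_cell side_i.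
have fin_P U : P i U \is a fin_num by exact: fin_num_measure.
apply: (mnormalize_scale (c := c)); rewrite /= ?/mrestr //.
- by apply: prode_fin_num => j _; exact: fin_num_measure.
- exact: (massE setT).
- (* An output of prior predictive probability zero: the posterior is then
     [cellwise_posterior], itself a product distribution. *)
  move=> _; rewrite -[LHS]/(marginal (cellwise_posterior h (pprod P) t) i A).
  rewrite marginal_pprod ti -[RHS]/(cell_posterior h (P i) None A).
  by rewrite !cell_posterior_None !marginal_pprod.
Qed.

End suppression.

Theorem proposition8 (R : realType) (n r h : nat) (alpha : R)
  (hn : (1 <= n)%N) (hr : (2 <= r)%N) (hh : (2 <= h)%N)
  (alpha_gt0 : 0 < alpha) (alpha_le1 : alpha <= 1) (hrh : (r <= h)%N) :
  PP (suppression n h) (cellwise_posterior h)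
     (log_scores n r) (product_priors n h alpha) (- ln alpha) 0.
Proof.
rewrite /PP subr0.
apply: le_ereal_inf_tmp => _ [_ [i _ <-] <-].
apply: le_ereal_inf_tmp => _ [x _ <-].
apply: le_ereal_inf_tmp => _ [_ [P Palpha <-] <-].
rewrite suppression_dirac diracE mem_set//= /log_score.
case: ltnP => [xr|_]; last by rewrite /esub eqxx lee_fin oppr_ge0 ln_le0.
have xh : (tnth x i < h)%N by exact: leq_trans hrh.
rewrite marginal_posterior// marginal_pprod cell_posterior_None.
rewrite (_ : [set tnth x i] `&` below h = [set tnth x i]); last first.
  by apply/setIidl => _ ->.
have pE : P i (below h) = (fine (P i (below h)))%:E.
  by rewrite fineK//; exact: fin_num_measure.
have qE : P i [set tnth x i] = (fine (P i [set tnth x i]))%:E.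
  by rewrite fineK//; exact: fin_num_measure.
have alpha_p : alpha <= fine (P i (below h)).
  by rewrite -lee_fin -pE; exact: Palpha.
have p1 : fine (P i (below h)) <= 1 by rewrite -lee_fin -pE probability_le1.
rewrite {1}pE eqe gt_eqF ?(lt_le_trans alpha_gt0)// qE -EFinM.
by apply: esub_lne_le => //; exact: fine_ge0.
Qed.
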